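(* For every integer $n\ge 1$ we have $\tau(n) < \dfrac{47n^2}{72}+2n$.
   Context: A word of length $n$ is a finite sequence $x=x[1\ldots n]$ of letters from some alphabet (alphabets of any size are allowed); $x[i\ldots j]$ denotes the factor occupying positions $i$ through $j$. A word has period $p\ge 1$ if $x[i]=x[i+p]$ whenever both positions lie in the word. A run in $x$ is an occurrence of a factor $x[i\ldots j]$ (identified by its pair of positions $(i,j)$) with minimum period $p$, of length $j-i+1\ge 2p$, and such that neither $x[i-1\ldots j]$ nor $x[i\ldots j+1]$ is a factor of $x$ with period $p$ (an extension that leaves the range of positions $1,\dots,n$ is not a factor). The total run length $TRL(w)$ of a word $w$ is the sum of the lengths of all runs in $w$ (runs at different positions are counted separately). Define $\tau(n)=\max\{TRL(w): |w|=n\}$, the maximum over all words of length $n$ over any alphabet. *)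

(* Defs.v *)
From mathcomp Require Import all_boot all_order all_algebra.

Set Implicit Arguments.
Unset Strict Implicit.
Unset Printing Implicit Defensive.

(* Words are sequences over an arbitrary eqType.  Letters inside has_period
   are indexed from 0; factor positions are numbered from 1. *)

Definition has_period (T : eqType) (p : nat) (u : seq T) : bool :=
  (0 < p) && all (fun k => onth u k == onth u (k + p)) (iota 0 (size u - p)).

Lemma has_periodP (T : eqType) (p : nat) (u : seq T) :
  reflect (0 < p /\ forall k, k + p < size u -> onth u k = onth u (k + p))
          (has_period p u).
Proof.
apply: (iffP andP) => [[p0 /allP h]|[p0 h]]; split=> //.
  by move=> k hk; apply/eqP/h; rewrite mem_iota add0n ltn_subRL addnC.
by apply/allP => k; rewrite mem_iota add0n /= ltn_subRL addnC => /h ->.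
Qed.

Lemma has_period_ex (T : eqType) (u : seq T) : exists p, has_period p u.
Proof.
by exists (size u).+1; apply/has_periodP; split=> // k; rewrite ltnNge ltnW ?ltn_addl.
Qed.

Definition min_period (T : eqType) (u : seq T) : nat := ex_minn (has_period_ex u).

Definition is_factor_pos (T : eqType) (x : seq T) (i j : nat) : bool :=
  [&& 0 < i, i <= j & j <= size x].

(* x[i..j], meaningful when is_factor_pos x i j holds. *)
Definition factor (T : eqType) (x : seq T) (i j : nat) : seq T :=
  drop i.-1 (take j x).

Definition factor_with_period (T : eqType) (x : seq T) (p i j : nat) : bool :=
  is_factor_pos x i j && has_period p (factor x i j).

(* For i = 1 the pair (i.-1, j) = (0, j) is not a factor position. *)
Definition is_run (T : eqType) (x : seq T) (i j : nat) : bool :=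
  let p := min_period (factor x i j) in
  [&& is_factor_pos x i j,
      2 * p <= j - i + 1,
      ~~ factor_with_period x p i.-1 j &
      ~~ factor_with_period x p i j.+1].

Definition TRL (T : eqType) (x : seq T) : nat :=
  \sum_(1 <= i < (size x).+1) \sum_(i <= j < (size x).+1 | is_run x i j)
    (j - i + 1).

Definition is_max_TRL (n m : nat) : Prop :=
  (exists (T : eqType) (x : seq T), size x = n /\ TRL x = m) /\
  (forall (T : eqType) (x : seq T), size x = n -> TRL x <= m).

Lemma eq_has_period_map (T S : eqType) (f : T -> S) (p : nat) (u : seq T) :
  {in u &, injective f} -> has_period p (map f u) = has_period p u.
Proof.
move=> inj_f; rewrite /has_period size_map; congr (_ && _).
apply: eq_all => k; rewrite !onth_map.
case ek: (onth u k) => [a|]; case el: (onth u (k + p)) => [b|] //=.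
have ua : a \in u by apply/onthP; exists k.
have ub : b \in u by apply/onthP; exists (k + p).
by apply/eqP/eqP => [[/inj_f ->]|[->]].
Qed.

Lemma TRL_map (T S : eqType) (f : T -> S) (x : seq T) :
  {in x &, injective f} -> TRL (map f x) = TRL x.
Proof.
move=> inj_f.
have injF i j : {in factor x i j &, injective f}.
  by move=> a b /mem_drop/mem_take xa /mem_drop/mem_take xb; apply: inj_f.
have facE i j : factor (map f x) i j = map f (factor x i j).
  by rewrite /factor -map_take -map_drop.
have posE i j : is_factor_pos (map f x) i j = is_factor_pos x i j.
  by rewrite /is_factor_pos size_map.
have minE i j : min_period (factor (map f x) i j) = min_period (factor x i j).
  apply: eq_ex_minn => p; rewrite facE; exact: eq_has_period_map.
have fwpE p i j : factor_with_period (map f x) p i j = factor_with_period x p i j.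
  by rewrite /factor_with_period posE facE eq_has_period_map.
rewrite /TRL size_map; apply: eq_bigr => i _; apply: eq_bigl => j.
by rewrite /is_run posE minE !fwpE.
Qed.

(* An alphabet of size n + 1 suffices for words of length n. *)
Lemma max_TRL_exists (n : nat) : {m : nat | is_max_TRL n m}.
Proof.
exists (\max_(t : n.-tuple 'I_n.+1) TRL t); split.
  have [|t ->] := @eq_bigmax (n.-tuple 'I_n.+1) (fun t => TRL t).
    by rewrite card_tuple card_ord expn_gt0.
  by exists 'I_n.+1, t; rewrite size_tuple.
move=> T x sx; pose f a : 'I_n.+1 := inord (index a x).
have inj_f : {in x &, injective f}.
  move=> a b xa xb /(congr1 val); rewrite /= !inordK ?ltnS -?sx ?index_size //.
  by move=> e; rewrite -(nth_index a xa) e nth_index.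
rewrite -(TRL_map inj_f).
have st : size (map f x) == n by rewrite size_map sx.
exact: (leq_bigmax (Tuple st)).
Qed.

Definition tau (n : nat) : nat := sval (max_TRL_exists n).

Lemma tauP (n : nat) : is_max_TRL n (tau n).
Proof. exact: svalP. Qed.

(* Main.v *)
Require Import Defs.
From mathcomp Require Import all_boot all_order all_algebra zify lra.
Import Order.TTheory GRing.Theory Num.Theory.
Local Open Scope ring_scope.
Set Implicit Arguments.
Unset Strict Implicit.
Unset Printing Implicit Defensive.

(** Group the runs of a word of length n by their period p, and let k be the
    number of runs of period p and T their total length.  Two runs of the same
    period overlap in fewer than p positions, so deleting the last p - 1
    positions of each leaves disjoint cores inside [0, n - p + 1).  Each core
    has at least p + 1 positions, hence T <= n - p + 1 + k (p - 1) and
    k (p + 1) <= n - p + 1 ([sum_disjoint_cores]).  Summed over p <= n/2 this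
    alone gives only about 3 n^2 / 4.

    The missing information is that the values of k add up to at most n, the
    runs theorem ([card_runs]), proved with the Lyndon roots of Bannai, I,
    Inenaga, Nakashima, Takeda and Tsuruta.  The letter that breaks the period
    on the right of a run is either smaller or larger than the letter one
    period before it.  In whichever of the two opposite alphabet orders makes
    it smaller, the run contains a Lyndon factor [k, k + p) starting strictly
    after the start of the run, and k + p is the first later position whose
    suffix is smaller than the suffix at k ([run_marks]).  So k and the order
    determine p; and the two orders cannot both mark k, because the suffixes at
    k and k + 1 compare in opposite ways in them ([marks_inj]).  Thus distinct
    runs have distinct marked positions.

    The two estimates are combined by linear duality: a run is charged 2n/9,
    and what remains of T is at most 7n/9 for every p, plus n/9 when
    p > 2n/9, because (n - 2p)(9p - 2n) <= np amounts to 2 (3p - n)^2 >= 0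
    ([total_length_period]).  Adding up,
    2n^2/9 + (n/2)(7n/9) + (n/2 - 2n/9)(n/9) + O(n) = 52 n^2 / 81 + O(n),
    and 52/81 < 47/72. *)

(** * Runs in sequences of integers *)

(** Positions count from 0 and [[a, b)] is half-open.  Letters are integers so
    that negation reverses the order of the alphabet. *)
Definition periodic_on (f : nat -> int) (p a b : nat) : Prop :=
  forall t, (a <= t)%N -> (t + p < b)%N -> f t = f (t + p)%N.

(** The right condition has no clause for a run ending with the word: the
    sequence goes on with a letter that does not occur in the word. *)
Record run_on (f : nat -> int) (a b p : nat) : Prop := RunOn {
  run_period_gt0 : (0 < p)%N;
  run_two_periods : (a + 2 * p <= b)%N;
  run_periodic : periodic_on f p a b;
  run_left_max : (0 < a)%N -> f a.-1 <> f (a.-1 + p)%N;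
  run_right_max : f b <> f (b - p)%N;
  run_period_min : forall d, (0 < d < p)%N -> ~ periodic_on f d a b }.

Lemma run_on_opp {f a b p} : run_on f a b p -> run_on (fun t => - f t) a b p.
Proof.
case=> p0 pp per lm rm mn; split=> //.
- by move=> t h1 h2; rewrite per.
- by move=> /lm h /oppr_inj.
- by move=> /oppr_inj.
- by move=> d /mn h per'; apply: h => t h1 h2; apply/oppr_inj/per'.
Qed.

(** The union of two intervals of period p that share p positions again has
    period p, so that maximality forces both runs to coincide with it. *)
Lemma run_on_overlap f a b a' b' p k :
    run_on f a b p -> run_on f a' b' p ->
  (a <= k)%N -> (k + p <= b)%N -> (a' <= k)%N -> (k + p <= b')%N ->
  a = a' /\ b = b'.
Proof.
wlog suff le : a b a' b' / run_on f a b p -> run_on f a' b' p ->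
    (a <= k)%N -> (k + p <= b)%N -> (a' <= k)%N -> (k + p <= b')%N ->
    (a <= a')%N /\ (b' <= b)%N.
  move=> r r' h1 h2 h3 h4.
  have := le _ _ _ _ r r' h1 h2 h3 h4; have := le _ _ _ _ r' r h3 h4 h1 h2.
  lia.
move=> r r' h1 h2 h3 h4; split; rewrite leqNgt; apply/negP => lt.
  apply: (run_left_max r); first lia.
  by apply: (run_periodic r'); lia.
apply: (run_right_max r).
have -> : f b = f (b - p + p)%N by congr f; lia.
by apply/esym/(run_periodic r'); lia.
Qed.

(** * Lexicographic comparison of suffixes *)

Definition lexlt (g : nat -> int) (s t : nat) : Prop :=
  exists l, (forall m, (m < l)%N -> g (s + m)%N = g (t + m)%N) /\
            g (s + l)%N < g (t + l)%N.

Definition lexle (g : nat -> int) (s t : nat) : Prop :=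
  (forall m, g (s + m)%N = g (t + m)%N) \/ lexlt g s t.

Lemma lexlt_asym g s t : lexlt g s t -> ~ lexlt g t s.
Proof.
move=> [l [e lt]] [l' [e' lt']].
case: (ltngtP l l') => h.
- by rewrite e' // ltxx in lt.
- by rewrite e // ltxx in lt'.
- by rewrite h in lt; have := lt_trans lt lt'; rewrite ltxx.
Qed.

Lemma lexlt_opp g s t : lexlt g s t -> ~ lexlt (fun u => - g u) s t.
Proof.
move=> h [l [e lt]]; apply: (lexlt_asym h); exists l; split.
  by move=> m /e /oppr_inj.
by rewrite -ltrN2.
Qed.

Lemma lexlt_trans g t s u : lexlt g s t -> lexlt g t u -> lexlt g s u.
Proof.
move=> [l [e lt]] [l' [e' lt']]; exists (minn l l'); split.
  by move=> m h; rewrite e ?e' //; lia.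
case: (ltngtP l l') => h.
- by rewrite -e'.
- by rewrite e.
- by rewrite -h in lt'; apply: lt_trans lt lt'.
Qed.

Lemma lexle_trans g t s u : lexle g s t -> lexle g t u -> lexle g s u.
Proof.
move=> [e|h] [e'|h']; [left=> m|right|right|right].
- by rewrite e.
- by case: h' => l [h1 h2]; exists l; split=> [m /h1|]; rewrite e.
- by case: h => l [h1 h2]; exists l; split=> [m /h1|]; rewrite -e'.
- exact: lexlt_trans h h'.
Qed.

(** Periodicity makes the first difference between two suffixes occur within
    the first p letters, so that a finite search decides the comparison. *)
Lemma lexle_total_periodic g p : (0 < p)%N -> (forall m, g (m + p)%N = g m) ->
  forall s t, lexle g s t \/ lexle g t s.
Proof.
move=> p0 per s t.
have [/forallP e|] := boolP [forall m : 'I_p, g (s + m)%N == g (t + m)%N].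
  left; left=> m.
  have shift c : forall q r, g (c + (q * p + r))%N = g (c + r)%N.
    elim=> // q IH r; rewrite mulSn.
    by rewrite (_ : (c + (p + q * p + r) = c + (q * p + r) + p)%N) ?per //; lia.
  rewrite (divn_eq m p) !shift.
  by apply/eqP/(e (Ordinal (ltn_pmod m p0))).
rewrite negb_forall => /existsP[m0 m0P].
have ex : exists m, g (s + m)%N != g (t + m)%N by exists m0.
case: (ex_minnP ex) => l ne mn.
have e m : (m < l)%N -> g (s + m)%N = g (t + m)%N.
  by move=> h; apply/eqP; apply: contraTT h => /mn; rewrite -leqNgt.
case: (ltgtP (g (s + l)%N) (g (t + l)%N)) ne => // lt _; [left|right]; right.
  by exists l.
by exists l; split=> // m /e.
Qed.

Lemma least_below (R : nat -> nat -> Prop) (N : nat) :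
    (forall s t, R s t \/ R t s) -> (forall s t u, R s t -> R t u -> R s u) ->
  exists a, (a <= N)%N /\ forall b, (b <= N)%N -> R a b.
Proof.
move=> tot tr; have refl s : R s s by case: (tot s s).
elim: N => [|N [a [aN aP]]].
  by exists 0%N; split=> // b; rewrite leqn0 => /eqP->.
case: (tot a N.+1) => h; [exists a | exists N.+1]; split=> //.
- exact: leqW.
- by move=> b; rewrite leq_eqVlt => /orP[/eqP->|] //; apply: aP.
- move=> b; rewrite leq_eqVlt => /orP[/eqP->|/aP] //; exact: tr.
Qed.

(** * Lyndon roots *)

(** The factor [[k, k + p)] is a Lyndon word: it is smaller than each of its
    proper suffixes, and the first difference occurs before the suffix ends,
    a Lyndon word having no border. *)
Definition lyndon_at (g : nat -> int) (k p : nat) : Prop :=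
  forall t, (k < t < k + p)%N -> exists l, [/\ (t + l < k + p)%N,
    forall m, (m < l)%N -> g (k + m)%N = g (t + m)%N & g (k + l)%N < g (t + l)%N].

(** Among the p rotations of the period, starting at [a + 1, ..., a + p], take
    the least one.  Minimality of p makes it strictly least; it is unbordered,
    since a border would make the rotation that starts at the border at most
    as large.  The start [a] itself is avoided so that the position before the
    root still belongs to the run, which [lyndon_at_unit] needs. *)
Lemma run_lyndon_root g a b p : run_on g a b p ->
  exists k, (a < k <= a + p)%N /\ lyndon_at g k p.
Proof.
move=> r; have p0 := run_period_gt0 r.
have two := run_two_periods r.
(* z extends the run periodically, without end. *)
pose z m := g (a + m %% p)%N.
have zper m : z (m + p)%N = z m by rewrite /z modnDr.
have gz m : (a + m < b)%N -> g (a + m)%N = z m.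
  elim/ltn_ind: m => m IH mb; have [mp|pm] := ltnP m p; first by rewrite /z modn_small.
  rewrite -(subnK pm) zper -IH; try lia.
  by rewrite addnA -(run_periodic r) //; lia.
have [o [op omin]] := @least_below (fun s t => lexle z s.+1 t.+1) p.-1
  (fun s t => lexle_total_periodic p0 zper s.+1 t.+1)
  (fun s t u => @lexle_trans z t.+1 s.+1 u.+1).
have {}omin s : (0 < s)%N -> lexle z o.+1 s.
  move=> s0; have := omin (s.-1 %% p)%N; have lt := ltn_pmod s.-1 p0.
  move=> /(_ ltac:(lia)) h; apply: lexle_trans h _; left=> m.
  rewrite /z; congr (g (a + _)%N); rewrite -addn1 -addnA modnDml.
  by congr modn; lia.
exists (a + o.+1)%N; split; first lia.
move=> t /andP[kt tk]; pose d := (t - (a + o.+1))%N.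
have d0 : (0 < d)%N by rewrite subn_gt0.
have dp : (d < p)%N by rewrite /d; lia.
(* If the rotations at distance d agreed, d < p would be a period of the run. *)
have [all_eq|[l [e lt]]] := omin (o.+1 + d)%N isT.
  case: (@run_period_min _ _ _ _ r d) => [|u au ub]; first by rewrite d0.
  have zd m : z (m + d)%N = z m.
    have := all_eq (m + p * o.+1 - o.+1)%N.
    rewrite (_ : (o.+1 + (m + p * o.+1 - o.+1) = o.+1 * p + m)%N); last by nia.
    rewrite (_ : (o.+1 + d + (m + p * o.+1 - o.+1) = o.+1 * p + (m + d))%N); last by nia.
    by rewrite /z !modnMDl.
  by rewrite -(subnKC au) -addnA !gz ?zd //; lia.
(* Otherwise the suffix of length p - d of the root is a border; past it, the
   rotation by d continues as the least rotation itself, so the first difference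
   found there contradicts minimality against the rotation by p - d. *)
have lsmall : (l < p - d)%N.
  rewrite ltnNge; apply/negP => le.
  case: (omin (o.+1 + (p - d))%N isT) => [all_eq|lt'].
    have := all_eq (l - (p - d))%N.
    have := zper (o.+1 + (l - (p - d)))%N.
    rewrite (_ : (o.+1 + (l - (p - d)) + p = o.+1 + d + l)%N); last lia.
    rewrite (_ : (o.+1 + (p - d) + (l - (p - d)) = o.+1 + l)%N); last lia.
    by move=> h1 h2; rewrite h1 h2 ltxx in lt.
  apply: (lexlt_asym lt'); exists (l - (p - d))%N; split=> [m ml|].
    have := e (m + (p - d))%N ltac:(lia).
    rewrite (_ : (o.+1 + d + (m + (p - d)) = o.+1 + m + p)%N); last lia.
    by rewrite zper => <-; congr z; lia.
  have := zper (o.+1 + (l - (p - d)))%N.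
  rewrite (_ : (o.+1 + (l - (p - d)) + p = o.+1 + d + l)%N); last lia.
  by rewrite (_ : (o.+1 + (p - d) + (l - (p - d)) = o.+1 + l)%N) => [<-|]; last lia.
have tE m : (t + m = a + (o.+1 + d + m))%N by rewrite /d; lia.
exists l; split=> [|m ml|]; rewrite ?tE; first lia.
  by rewrite -addnA !gz ?e //; lia.
by rewrite -addnA !gz //; lia.
Qed.

(** The position k starts a Lyndon root of length p of the run [[a, b)] for
    one of the two orders of the alphabet, and no longer Lyndon factor starts
    at k for that order. *)
Definition marks (f : nat -> int) (a b p k : nat) : Prop :=
  (a < k <= a + p)%N /\ exists g : nat -> int,
    [/\ g = f \/ g = (fun t => - f t), lyndon_at g k p & lexlt g (k + p) k].

(** In the order that makes the letter [f b] smaller than [f (b - p)], the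
    suffix at [k + p] agrees with the suffix at [k] up to [b] and is then
    smaller. *)
Lemma run_marks f a b p : run_on f a b p -> exists k, marks f a b p k.
Proof.
move=> r.
have low g : run_on g a b p -> g b < g (b - p)%N -> exists k,
    [/\ (a < k <= a + p)%N, lyndon_at g k p & lexlt g (k + p) k].
  move=> {}r lt; have [k [ak ly]] := run_lyndon_root r; exists k; split=> //.
  have two := run_two_periods r.
  exists (b - (k + p))%N; split=> [m mb|].
    by rewrite addnAC -(run_periodic r) //; lia.
  by move: lt; congr (g _ < g _); lia.
case: (ltgtP (f b) (f (b - p)%N)) => lt.
- by have [k [? ? ?]] := low f r lt; exists k; split=> //; exists f; split=> //; left.
- have [|k [? ? ?]] := low _ (run_on_opp r); first by rewrite ltrN2.
  by exists k; split=> //; exists (fun t => - f t); split=> //; right.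
- by case: (run_right_max r).
Qed.

Lemma lyndon_at_lexlt g k p t : lyndon_at g k p -> (k < t < k + p)%N -> lexlt g k t.
Proof. by move=> h /h [l [_ h1 h2]]; exists l. Qed.

Lemma marks_same_order g k p p' :
  (0 < p)%N -> lexlt g (k + p) k -> lyndon_at g k p' -> (p' <= p)%N.
Proof.
move=> p0 h ly; rewrite leqNgt; apply/negP => lt.
by apply: (lexlt_asym h); apply: (lyndon_at_lexlt ly); lia.
Qed.

(** A Lyndon word of length at least 2 ends with a letter larger than its
    first, and by periodicity that last letter also stands just before the
    root.  This separates roots of length 1 from longer ones. *)
Lemma lyndon_at_unit f a b p k g : run_on f a b p -> (a < k <= a + p)%N -> (1 < p)%N ->
  g = f \/ g = (fun t => - f t) -> lyndon_at g k p -> f k.-1 <> f k.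
Proof.
move=> r ak p1 gE /(_ (k + p - 1)%N) [|l [h1 _ lt] e]; first lia.
have two := run_two_periods r.
have := @run_periodic _ _ _ _ r k.-1; rewrite e => /(_ ltac:(lia) ltac:(lia)) e'.
have l0 : l = 0%N by lia.
move: lt; rewrite l0 !addn0 (_ : (k + p - 1 = k.-1 + p)%N); last lia.
by case: gE => ->; rewrite e' ltxx.
Qed.

(** Same order: both periods are the distance to the next smaller suffix.
    Opposite orders: roots longer than 1 compare the suffixes at [k] and [k + 1]
    in contradictory ways, and a root of length 1 repeats the letter before it
    while a longer root does not.  So the periods agree, and the runs share the
    root. *)
Lemma marks_inj f a b p a' b' p' k :
    run_on f a b p -> run_on f a' b' p' -> marks f a b p k -> marks f a' b' p' k ->
  a = a' /\ b = b'.
Proof.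
move=> r r' [ak [g [gE ly dn]]] [ak' [g' [gE' ly' dn']]].
have p0 := run_period_gt0 r; have p0' := run_period_gt0 r'.
have two := run_two_periods r; have two' := run_two_periods r'.
suff pp : p = p'.
  by move: r' ak' two'; rewrite -pp => r' ak' two'; apply: (@run_on_overlap f a b a' b' p k); lia || assumption.
have same (E : g = g') : p = p'.
  move: ly' dn'; rewrite -E => ly' dn'.
  by apply/eqP; rewrite eqn_leq (marks_same_order p0' dn' ly) (marks_same_order p0 dn ly').
have diff : (forall s t, lexlt g s t -> ~ lexlt g' s t) -> p = p'.
  move=> opp; have [p1|p1] := leqP p 1; have [p1'|p1'] := leqP p' 1.
  - lia.
  - case: (lyndon_at_unit r' ak' p1' gE' ly').
    have := @run_periodic _ _ _ _ r k.-1; rewrite (_ : (k.-1 + p = k)%N); last lia.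
    by apply; lia.
  - case: (lyndon_at_unit r ak p1 gE ly).
    have := @run_periodic _ _ _ _ r' k.-1; rewrite (_ : (k.-1 + p' = k)%N); last lia.
    by apply; lia.
  - case: (opp k k.+1); first by apply: (lyndon_at_lexlt ly); lia.
    by apply: (lyndon_at_lexlt ly'); lia.
case: gE gE' => gE [] gE'; rewrite gE gE' in same diff.
- exact: same.
- apply: diff => s t; exact: lexlt_opp.
- apply: diff => s t h1 h2; exact: (lexlt_opp h2 h1).
- exact: same.
Qed.

(** * Runs of a word *)

(** Past the end of the word the value is 0, which no letter receives. *)
Definition letter (T : eqType) (x : seq T) (t : nat) : int :=
  if onth x t is Some c then (index c x).+1%:Z else 0.

Lemma letter_inj (T : eqType) (x : seq T) (s t : nat) :
  letter x s = letter x t <-> onth x s = onth x t.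
Proof.
split=> [|e]; last by rewrite /letter e.
rewrite /letter; case es: (onth x s) => [c|]; case et: (onth x t) => [c'|] // [].
have xc : c \in x by apply/onthP; exists s.
have xc' : c' \in x by apply/onthP; exists t.
by move=> /(congr1 (nth c x)); rewrite !nth_index // => ->.
Qed.

Lemma onth_factor (T : eqType) (x : seq T) (i j k : nat) :
  (i.-1 + k < j)%N -> onth (factor x i j) k = onth x (i.-1 + k).
Proof.
move=> h; rewrite /factor !onthE map_drop nth_drop map_take nth_take //.
Qed.

Lemma has_period_factor (T : eqType) (x : seq T) (p i j : nat) :
    (i.-1 <= j <= size x)%N -> (0 < p)%N ->
  has_period p (factor x i j) <-> periodic_on (letter x) p i.-1 j.
Proof.
move=> ij p0.
have sz : size (factor x i j) = (j - i.-1)%N.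
  by rewrite /factor size_drop size_takel //; case/andP: ij.
split=> [/has_periodP[_ h] t at_ tb|h].
  apply/letter_inj; have := h (t - i.-1)%N; rewrite sz !onth_factor; try lia.
  by rewrite addnA subnKC // => -> //; lia.
apply/has_periodP; split=> // k; rewrite sz => hk.
by rewrite !onth_factor ?addnA; try lia; apply/letter_inj/h; lia.
Qed.

Lemma is_run_run_on (T : eqType) (x : seq T) (i j : nat) : is_run x i j ->
  [/\ (0 < i)%N, (j <= size x)%N
    & run_on (letter x) i.-1 j (min_period (factor x i j))].
Proof.
rewrite /is_run /min_period; case: ex_minnP => p hp pmin.
case/and4P=> /and3P[i0 ij jn] two lm rm.
have p0 : (0 < p)%N by case/andP: hp.
have per : periodic_on (letter x) p i.-1 j by apply/has_period_factor => //; lia.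
split=> //; split=> //.
- lia.
- move=> i1 e; case/negP: lm; apply/andP; split; first by rewrite /is_factor_pos; lia.
  apply/has_period_factor => //; first lia.
  move=> t; rewrite leq_eqVlt => /orP[/eqP<- //|] h tj; apply: per => //; lia.
- move=> e; have jx : (j < size x)%N.
    move: e (onthTE x j) (onthTE x (j - p)); rewrite /letter.
    by case: (onth x j) => [?|]; case: (onth x (j - p)) => [?|] //=; lia.
  case/negP: rm; apply/andP; split; first by rewrite /is_factor_pos; lia.
  apply/has_period_factor => //; first lia.
  move=> t ht; rewrite ltnS leq_eqVlt => /orP[/eqP tj|]; last exact: per.
  by rewrite tj e; congr letter; lia.
- move=> d dp h; have : has_period d (factor x i j) by apply/has_period_factor => //; lia.
  by move/pmin; lia.
Qed.

(** * Arithmetic of a single period *)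

Lemma sum_interval (u v N : nat) :
  (\sum_(t < N) (u <= t < v) = minn v N - u)%N.
Proof.
elim: N => [|N IH]; first by rewrite big_ord0; lia.
by rewrite big_ord_recr IH /=; lia.
Qed.

(** Here S is the total size of the cores of the k runs of period p in a word
    of length N.  With S at its upper bound the claim reads
    (k - 1)(9(p - 1) - 2N) <= 0 for small p and <= N for large p.  The latter
    uses k - 1 <= (N - 2p) / (p + 1) and the square of 3(p - 1) - N; the
    charge 2N/9 per run is chosen to make that square appear. *)
Lemma total_length_arith (N p k S : nat) :
    (0 < p)%N -> (0 < k)%N -> (2 * p <= N)%N -> (k * (p + 1) <= S)%N ->
    (S <= N + 1 - p)%N ->
  (9 * (S + k * (p - 1)) <= 2 * N * k + 7 * N + (2 * N < 9 * p) * N)%N.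
Proof.
(* The names change: p becomes q + 1 and k becomes k + 1. *)
case: p k => [//|q] [//|k] _ _; rewrite subn1 /= => pN kS SN.
have kq : (k * (q + 2) <= N - 2 * q - 2)%N by nia.
case: ltnP => h; last by nia.
rewrite mul1n.
have key : (9 * (k * q) <= 2 * N * k + N)%N.
  case: (leqP (9 * q) (2 * N)) => h'; first nia.
  have [e eE] : exists e, (9 * q = 2 * N + e)%N by exists (9 * q - 2 * N)%N; lia.
  suff : (k * e <= N)%N by nia.
  (* Multiplying by p + 1 = q + 2 brings in the bound on k. *)
  rewrite -(leq_pmul2r (_ : 0 < q + 2)%N) ?addn2 //.
  apply: (@leq_trans ((N - 2 * q - 2) * e)%N); first by nia.
  have sq : (12 * (q * N) <= 18 * (q * q) + 2 * (N * N))%N.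
    have := sqr_ge0 (3 * q%:Z - N%:Z); nia.
  nia.
nia.
Qed.

(** * Counting runs *)

Section Counting.
Variables (T : eqType) (x : seq T).
Local Notation n := (size x).

Definition runs : {set 'I_n.+1 * 'I_n.+1} := [set r : 'I_n.+1 * 'I_n.+1 | is_run x r.1 r.2].

Definition run_length (r : 'I_n.+1 * 'I_n.+1) : nat := (r.2 - r.1 + 1)%N.

Definition run_period (r : 'I_n.+1 * 'I_n.+1) : nat := min_period (factor x r.1 r.2).

Lemma TRL_runs : TRL x = (\sum_(r in runs) run_length r)%N.
Proof.
rewrite /TRL (big_nat_widenl _ 0) // big_mkord.
rewrite (eq_bigr (fun i : 'I_n.+1 => \sum_(j < n.+1 | is_run x i j) (j - i + 1)))%N.
  rewrite pair_big_dep; apply: eq_bigl => r; rewrite inE /= andb_idl // => /is_run_run_on[].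
  by [].
move=> i i0; rewrite (big_nat_widenl _ 0) // big_mkord; apply: eq_bigl => j.
by rewrite andb_idr // => /and4P[/and3P[]].
Qed.

Lemma mem_runs r : r \in runs ->
  [/\ (0 < r.1)%N, (r.2 <= n)%N & run_on (letter x) r.1.-1 r.2 (run_period r)].
Proof. by rewrite inE; exact: is_run_run_on. Qed.

(** The runs theorem: sending a run to a position that it marks is injective,
    and position 0 is never marked. *)
Lemma card_runs : (#|runs| <= n)%N.
Proof.
have mark (r : 'I_n.+1 * 'I_n.+1) : exists k : 'I_n.+1, r \in runs ->
    (0 < k)%N /\ marks (letter x) r.1.-1 r.2 (run_period r) k.
  case: (boolP (r \in runs)) => [|_]; last by exists ord0.
  case/mem_runs=> i0 jn rr; have [k hk] := run_marks rr.
  have kn : (k < n.+1)%N by case: hk => ? _; have := run_two_periods rr; lia.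
  by exists (Ordinal kn) => _; split=> //=; case: hk => ? _; lia.
have [f fP] := fin_all_exists mark.
rewrite -(card_in_imset (f := f)); last first.
  move=> [i j] [i' j'] rr rr' e.
  have [_ hm] := fP _ rr; have [_] := fP _ rr'; rewrite -e => hm'.
  have [i0 _ r1] := mem_runs rr; have [i0' _ r2] := mem_runs rr'.
  have [e1 e2] := marks_inj r1 r2 hm hm'.
  by congr pair; apply: val_inj; rewrite /= in e1 e2 i0 i0' *; lia.
apply: (@leq_trans #|[set~ (ord0 : 'I_n.+1)]|).
  apply/subset_leq_card/subsetP => k /imsetP[r /fP[k0 _] ->].
  by rewrite !inE; apply: contraTneq k0 => ->.
by rewrite cardsC1 card_ord.
Qed.

Definition runs_of (p : nat) : {set 'I_n.+1 * 'I_n.+1} :=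
  [set r in runs | run_period r == p].

Lemma mem_runs_of p r : r \in runs_of p ->
  [/\ (0 < r.1)%N, (r.2 <= n)%N & run_on (letter x) r.1.-1 r.2 p].
Proof. by rewrite inE => /andP[/mem_runs[i0 jn rr] /eqP <-]. Qed.

(** The core of a run of period p consists of the positions t such that
    [[t, t + p)] lies in the run; by [run_on_overlap] no t belongs to two
    cores. *)
Lemma sum_disjoint_cores p :
  (\sum_(r in runs_of p) (run_length r + 1 - p) <= n + 1 - p)%N.
Proof.
have core (r : 'I_n.+1 * 'I_n.+1) : r \in runs_of p ->
    (run_length r + 1 - p = \sum_(t < n + 1 - p) (r.1.-1 <= t < r.2 + 1 - p))%N.
  rewrite sum_interval => /mem_runs_of[i0 jn rr].
  have := run_two_periods rr; have := run_period_gt0 rr; rewrite /run_length.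
  case: r i0 jn {rr} => i j /=; lia.
rewrite (eq_bigr _ core) exchange_big /=.
rewrite -[X in (_ <= X)%N]card_ord -sum1_card; apply: leq_sum => t _.
rewrite -big_mkcondr /= sum1_card; apply/card_le1_eqP => r r'.
move=> /andP[/mem_runs_of[i0 _ r1] h] /andP[/mem_runs_of[i0' _ r2] h'].
case: r r' i0 i0' r1 r2 h h' => [i j] [i' j'] /= i0 i0' r1 r2 h h'.
have [e1 e2] : i.-1 = i'.-1 /\ j = j' :> nat.
  by apply: (run_on_overlap (k := t) r1 r2); lia.
by congr pair; apply: val_inj => /=; lia.
Qed.

Lemma total_length_period p :
  (9 * (\sum_(r in runs_of p) run_length r) <=
   2 * n * #|runs_of p| + 7 * n + (2 * n < 9 * p) * n)%N.
Proof.
have [->|[r0 r0p]] := set_0Vmem (runs_of p); first by rewrite big_set0; lia.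
have facts r : r \in runs_of p -> [/\ (0 < p)%N, (2 * p <= n)%N & (2 * p <= run_length r)%N].
  move=> /mem_runs_of[i0 jn rr].
  have := run_two_periods rr; have := run_period_gt0 rr; rewrite /run_length.
  by case: r i0 jn {rr} => i j /= *; split=> //; lia.
have [p0 pn _] := facts _ r0p.
have -> : (\sum_(r in runs_of p) run_length r =
    \sum_(r in runs_of p) (run_length r + 1 - p) + #|runs_of p| * (p - 1))%N.
  rewrite -sum_nat_const -big_split /=; apply: eq_bigr => r /facts[_ _]; lia.
apply: total_length_arith => //.
- by rewrite card_gt0; apply/set0Pn; exists r0.
- by rewrite -sum_nat_const; apply: leq_sum => r /facts[_ _]; lia.
- exact: sum_disjoint_cores.
Qed.

(** The charges 2n/9 of all runs add up to at most 2n^2/9 by [card_runs], and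
    the remainders, one for each p <= n/2, to at most 34n^2/81 + O(n).
    The linear term pays for the roundings and for the empty class p = 0. *)
Lemma TRL_bound : (162 * TRL x <= 104 * n ^ 2 + 142 * n)%N.
Proof.
pose h := n./2.
have part (F : 'I_n.+1 * 'I_n.+1 -> nat) :
    (\sum_(r in runs) F r = \sum_(p < h.+1) \sum_(r in runs_of p) F r)%N.
  rewrite (partition_big (fun r => inord (run_period r) : 'I_h.+1) xpredT) //=.
  apply: eq_bigr => p _; apply: eq_bigl => r; rewrite [RHS]inE.
  case: (boolP (r \in runs)) => [/mem_runs[i0 jn rr]|//] /=.
  have := run_two_periods rr => two.
  by rewrite -val_eqE /= inordK // /h; lia.
have := leq_sum (index_enum 'I_h.+1) (fun p (_ : xpredT p) => total_length_period p).
rewrite -big_distrr /= -part -TRL_runs 2!big_split /=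
  sum_nat_const card_ord -big_distrr -big_distrl /=.
have -> : (\sum_(p < h.+1) #|runs_of p| = #|runs|)%N.
  by rewrite -[RHS]sum1_card part; apply: eq_bigr => p _; rewrite sum1_card.
have -> : (\sum_(p < h.+1) (2 * n < 9 * p) = h - (2 * n) %/ 9)%N.
  transitivity (\sum_(p < h.+1) ((2 * n) %/ 9 < p < h.+1))%N.
    by apply: eq_bigr => p _; rewrite ltn_ord andbT ltn_divLR // (mulnC 9%N).
  by rewrite sum_interval; lia.
have := card_runs; set m := (2 * n %/ 9)%N.
have hn : (2 * h <= n)%N by rewrite /h; lia.
have mn : (2 * n <= 9 * m + 8)%N by rewrite /m; lia.
move=> cn le.
have hm : (18 * (h - m) <= 5 * n + 16)%N by lia.
rewrite expnS expn1.
have := leq_mul (leqnn n) cn; have := leq_mul (leqnn n) hn.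
have := leq_mul (leqnn n) hm; move: le; move: (h - m)%N (#|runs|) => u v; lia.
Qed.

End Counting.

Theorem theorem8 (n : nat) (hn : (1 <= n)%N) :
  (tau n)%:R < 47 * n%:R ^+ 2 / 72 + 2 * n%:R :> rat.
Proof.
have [[T [x [sx <-]]] _] := tauP n.
have := TRL_bound x; rewrite sx -mulnn -(ler_nat rat) natrD !natrM expr2.
have : 1 <= n%:R :> rat by rewrite ler1n.
by have := sqr_ge0 (n%:R : rat); rewrite expr2; lra.
Qed.
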